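(* Let $1\le p\le\infty$, let $X$ be a pointed metric space, $E$ a Banach space and $T:X\to E$ a Lipschitz operator. The following properties are equivalent: (1) $T$ is strictly Lipschitz $p$-nuclear. (2) The linearization operator $\widehat T:\mathcal F(X)\to E$ is $p$-nuclear. Moreover, $\mathcal N_p^{SL}(X,E)=\mathcal N_p(\mathcal F(X),E)$ holds isometrically, via $T\mapsto\widehat T$.
   Context: Banach spaces are real. A pointed metric space $X$ has a distinguished point $0$. A Lipschitz operator $T:X\to E$ is a Lipschitz map with $T(0)=0$. $X^{\#}$ is the Banach space of Lipschitz functions $f:X\to\mathbb R$ with $f(0)=0$, normed by the Lipschitz constant. For $x,y\in X$, $\delta_{(x,y)}\in (X^{\#})^*$ is $\delta_{(x,y)}(f)=f(x)-f(y)$; $\mathcal F(X)$ is the closed linear span of all $\delta_{(x,y)}$ in $(X^{\#})^*$, and $\mathcal F(X)^*=X^{\#}$ isometrically. The linearization $\widehat T:\mathcal F(X)\to E$ is the unique bounded linear map with $\widehat T(\delta_{(x,0)})=T(x)$ for all $x\in X$. $1/p+1/p^*=1$. For a finite sequence in a Banach space $E$: $\|(e_i)\|_{l_p^{n,w}(E)}=\sup_{e^*\in B_{E^*}}(\sum_i|\langle e_i,e^*\rangle|^p)^{1/p}$ (maximum when $p=\infty$). A linear operator $R:E\to F$ is $p$-nuclear (in the sense of Cohen) if there is $C>0$ with $\sum_{i=1}^n|\langle R(x_i),y_i^*\rangle|\le C\|(x_i)\|_{l_p^{n,w}(E)}\|(y_i^* )\|_{l_{p^*}^{n,w}(F^*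 )}$ for all $n$, $x_i\in E$, $y_i^*\in F^*$; $\mathcal N_p(E,F)$ is the space of such operators, with norm $N_p(R)$ the smallest such $C$. $X\boxtimes E^*$ (Lipschitz tensor product) is the span of the functionals $\delta_{(x,y)}\boxtimes e^*: f\mapsto\langle f(x)-f(y),e^*\rangle$ on the space $Lip_0(X;E^{**})$ of Lipschitz maps $X\to E^{**}$ vanishing at $0$. For $u=\sum_{k=1}^l\delta_{(x_k,y_k)}\boxtimes s_k^*\in X\boxtimes E^*$ put $w_p^{SL}(u)=\inf\{\|(m_i)\|_{l_p^{n,w}(\mathcal F(X))}\|(e_i^* )\|_{l_{p^*}^{n,w}(E^* )}\}$, the infimum over all $n$ and all $m_i\in\mathcal F(X)$, $e_i^*\in E^*$ with $\sum_{i=1}^n m_i\otimes e_i^*=\sum_{k=1}^l\delta_{(x_k,y_k)}\otimes s_k^*$ in $\mathcal F(X)\otimes E^*$. $T:X\to E$ is strictly Lipschitz $p$-nuclear if there is $C>0$ such that for all $l$, $x_k,y_k\in X$, $s_k^*\in E^*$ ($1\le k\le l$), $\big|\sum_{k=1}^l\langle T(x_k)-T(y_k),s_k^*\rangle\big|\le C\,w_p^{SL}(u)$ with $u=\sum_{k=1}^l\delta_{(x_k,y_k)}\boxtimes s_k^*$. $\mathcal N_p^{SL}(X,E)$ is the space of such operators, with norm $N_p^{SL}(T)$ the smallest such $C$. *)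

(* Defs.v *)
From HB Require Import structures.
From mathcomp Require Import all_boot all_order all_algebra.
From mathcomp Require Import all_classical all_reals all_analysis.

Set Implicit Arguments.
Unset Strict Implicit.
Unset Printing Implicit Defensive.

Import Order.TTheory GRing.Theory Num.Theory.
Import numFieldNormedType.Exports.

Local Open Scope classical_set_scope.
Local Open Scope ring_scope.

Section LeastConstant.
Context {R : realType}.

(* Least [C >= 0] with [a i <= C * b i] for all [i]. *)
Definition least_const (I : Type) (a b : I -> R) : R :=
  inf [set C | 0 <= C /\ forall i, a i <= C * b i].

Lemma least_const_le I (a b : I -> R) C :
  0 <= C -> (forall i, a i <= C * b i) -> least_const a b <= C.
Proof. by move=> C0 H; apply: ge_inf => //; exists 0 => x []. Qed.

Lemma least_const_set_neq0 I (a b : I -> R) :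
  (forall i, 0 <= b i) -> (exists C, forall i, a i <= C * b i) ->
  [set C | 0 <= C /\ forall i, a i <= C * b i] !=set0.
Proof.
move=> b0 [C HC]; exists `|C|; split=> // j; apply: (le_trans (HC j)).
by rewrite ler_wpM2r// ler_norm.
Qed.

Lemma least_const_ge0 I (a b : I -> R) : 0 <= least_const a b.
Proof.
rewrite /least_const; set S := [set C | _].
have [->|/set0P S0] := eqVneq S set0; first by rewrite inf0.
by apply: lb_le_inf => // C [].
Qed.

Lemma least_constP I (a b : I -> R) :
  (forall i, 0 <= b i) -> (exists C, forall i, a i <= C * b i) ->
  forall i, a i <= least_const a b * b i.
Proof.
move=> b0 HC i; have ne := least_const_set_neq0 b0 HC.
have [bi|bi] := eqVneq (b i) 0.
  by case: ne => D [_ /(_ i)]; rewrite bi !mulr0.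
rewrite -ler_pdivrMr ?lt0r ?bi ?b0//.
by apply: lb_le_inf => // D [_ /(_ i)]; rewrite -ler_pdivrMr ?lt0r ?bi ?b0.
Qed.

End LeastConstant.

Section Lip0.
Context {R : realType} {X : metricType R} (o : X) (E : normedModType R).

Definition lip0_set : set (X -> E) := [set f | f o = 0 /\
  exists C : R, forall xy : X * X, `|f xy.1 - f xy.2| <= C * mdist xy.1 xy.2].

Definition lip0_pred : {pred X -> E} := mem lip0_set.

Record Lip0 := mkLip0 { lip0_fun :> X -> E ; _ : lip0_fun \in lip0_pred }.

HB.instance Definition _ := [isSub for lip0_fun].
HB.instance Definition _ := [Choice of Lip0 by <:].

Lemma lip0_submod : submod_closed lip0_pred.
Proof.
split=> [|a f g /set_mem[f0 [C HC]] /set_mem[g0 [D HD]]]; apply/mem_set.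
  by split=> //; exists 0 => xy; rewrite subrr normr0 mul0r.
split=> [|/=]; first by rewrite !fctE f0 g0 scaler0 addr0.
exists (`|a| * C + D) => xy; rewrite !fctE.
rewrite opprD addrACA -scalerBr (le_trans (ler_normD _ _))// normrZ mulrDl.
by rewrite lerD// -mulrA ler_wpM2l.
Qed.

HB.instance Definition _ := GRing.isSubmodClosed.Build R (X -> E)
  lip0_pred lip0_submod.
HB.instance Definition _ := [SubChoice_isSubLmodule of Lip0 by <:].

Lemma lip0D (f g : Lip0) x : (f + g) x = f x + g x.
Proof. by []. Qed.

Lemma lip0Z a (f : Lip0) x : (a *: f) x = a *: f x.
Proof. by []. Qed.

Definition lip_const (f : Lip0) : R :=
  least_const (fun xy : X * X => `|f xy.1 - f xy.2|)
              (fun xy => mdist xy.1 xy.2).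

Lemma lip0_base (f : Lip0) : f o = 0.
Proof. by have /set_mem[] := valP f. Qed.

Lemma lip_constP (f : Lip0) x y : `|f x - f y| <= lip_const f * mdist x y.
Proof.
have /set_mem[_ HC] := valP f.
by apply: (@least_constP _ _ _ _ _ HC (x, y)) => xy; exact: mdist_ge0.
Qed.

Lemma lip_const_le (f : Lip0) C : 0 <= C ->
  (forall x y, `|f x - f y| <= C * mdist x y) -> lip_const f <= C.
Proof. by move=> C0 H; apply: least_const_le => // -[x y]; exact: H. Qed.

Lemma lip_constD (f g : Lip0) : lip_const (f + g) <= lip_const f + lip_const g.
Proof.
apply: lip_const_le => [|x y]; first by rewrite addr_ge0// least_const_ge0.
rewrite !lip0D opprD addrACA mulrDl (le_trans (ler_normD _ _))//.
by rewrite lerD// lip_constP.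
Qed.

Lemma lip_constZ_le a (f : Lip0) : lip_const (a *: f) <= `|a| * lip_const f.
Proof.
apply: lip_const_le => [|x y]; first by rewrite mulr_ge0// least_const_ge0.
by rewrite !lip0Z -scalerBr normrZ -mulrA ler_wpM2l// lip_constP.
Qed.

Lemma lip_constZ a (f : Lip0) : lip_const (a *: f) = `|a| * lip_const f.
Proof.
apply/eqP; rewrite eq_le lip_constZ_le/=.
have [->|a0] := eqVneq a 0; first by rewrite normr0 mul0r least_const_ge0.
rewrite mulrC -ler_pdivlMr ?normr_gt0// mulrC -normfV.
by rewrite -{1}[f](scalerK a0) lip_constZ_le.
Qed.

Lemma lip_const_eq0 (f : Lip0) : lip_const f = 0 -> f = 0.
Proof.
move=> f0; apply/val_inj/funext => x /=.
have := lip_constP f x o; rewrite f0 mul0r normr_le0 lip0_base subr0.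
by move/eqP.
Qed.

HB.instance Definition _ := @Lmodule_isNormed.Build R Lip0 lip_const
  lip_constD lip_constZ lip_const_eq0.

Lemma lip0_normP (f : Lip0) x y : `|f x - f y| <= `|f| * mdist x y.
Proof. exact: lip_constP. Qed.

Lemma lip0_norm_le (f : Lip0) C : 0 <= C ->
  (forall x y, `|f x - f y| <= C * mdist x y) -> `|f| <= C.
Proof. exact: lip_const_le. Qed.

End Lip0.

Section BoundedLinear.
Context {R : realType}.
Implicit Types V W : normedModType R.

Definition blin_set V W : set (V -> W) := [set f | linear f /\
  exists C : R, forall v, `|f v| <= C * `|v|].

Definition blin_pred V W : {pred V -> W} := mem (@blin_set V W).

Record blin V W := mkBlin { blin_fun :> V -> W ; _ : blin_fun \in @blin_pred V W }.

HB.instance Definition _ V W := [isSub for @blin_fun V W].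
HB.instance Definition _ V W := [Choice of blin V W by <:].

Lemma blin_submod V W : submod_closed (@blin_pred V W).
Proof.
split=> [|a f g /set_mem[lf [C HC]] /set_mem[lg [D HD]]]; apply/mem_set.
  split=> [b u v|]; first by rewrite -[RHS]/(b *: 0 + 0) scaler0 addr0.
  by exists 0 => v; rewrite normr0 mul0r.
split=> [b u v|/=].
  rewrite -[LHS]/(a *: f _ + g _) -[RHS]/(b *: (a *: f u + g u) + _).
  by rewrite lf lg !scalerDr !scalerA [a * b]mulrC -[RHS]addrACA.
exists (`|a| * C + D) => v; rewrite -[(a *: f + g) v]/(a *: f v + g v).
rewrite (le_trans (ler_normD _ _))// normrZ mulrDl.
by rewrite lerD// -mulrA ler_wpM2l.
Qed.

HB.instance Definition _ V W := GRing.isSubmodClosed.Build R (V -> W)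
  (@blin_pred V W) (@blin_submod V W).
HB.instance Definition _ V W := [SubChoice_isSubLmodule of blin V W by <:].

Lemma blin_linear V W (f : blin V W) : linear f.
Proof. by have /set_mem[] := valP f. Qed.

HB.instance Definition _ V W (f : blin V W) :=
  GRing.isLinear.Build R V W *:%R (blin_fun f) (blin_linear f).

Lemma blinD V W (f g : blin V W) v : (f + g) v = f v + g v.
Proof. by []. Qed.

Lemma blinZ V W a (f : blin V W) v : (a *: f) v = a *: f v.
Proof. by []. Qed.

Definition op_norm V W (f : blin V W) : R :=
  least_const (fun v => `|f v|) (fun v => `|v|).

Lemma op_normP V W (f : blin V W) v : `|f v| <= op_norm f * `|v|.
Proof.
by have /set_mem[_ HC] := valP f; exact: (least_constP _ HC).
Qed.

Lemma op_norm_le V W (f : blin V W) C : 0 <= C ->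
  (forall v, `|f v| <= C * `|v|) -> op_norm f <= C.
Proof. exact: least_const_le. Qed.

Lemma op_normD V W (f g : blin V W) : op_norm (f + g) <= op_norm f + op_norm g.
Proof.
apply: op_norm_le => [|v]; first by rewrite addr_ge0// least_const_ge0.
rewrite blinD mulrDl (le_trans (ler_normD _ _))//.
by rewrite lerD// op_normP.
Qed.

Lemma op_normZ_le V W a (f : blin V W) : op_norm (a *: f) <= `|a| * op_norm f.
Proof.
apply: op_norm_le => [|v]; first by rewrite mulr_ge0// least_const_ge0.
by rewrite blinZ normrZ -mulrA ler_wpM2l// op_normP.
Qed.

Lemma op_normZ V W a (f : blin V W) : op_norm (a *: f) = `|a| * op_norm f.
Proof.
apply/eqP; rewrite eq_le op_normZ_le/=.
have [->|a0] := eqVneq a 0; first by rewrite normr0 mul0r least_const_ge0.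
rewrite mulrC -ler_pdivlMr ?normr_gt0// mulrC -normfV.
by rewrite -{1}[f](scalerK a0) op_normZ_le.
Qed.

Lemma op_norm_eq0 V W (f : blin V W) : op_norm f = 0 -> f = 0.
Proof.
move=> f0; apply/val_inj/funext => v /=.
by have := op_normP f v; rewrite f0 mul0r normr_le0 => /eqP.
Qed.

HB.instance Definition _ V W := @Lmodule_isNormed.Build R (blin V W)
  (@op_norm V W) (@op_normD V W) (@op_normZ V W) (@op_norm_eq0 V W).

Lemma blin_normP V W (f : blin V W) v : `|f v| <= `|f| * `|v|.
Proof. exact: op_normP. Qed.

Lemma blin_norm_le V W (f : blin V W) C : 0 <= C ->
  (forall v, `|f v| <= C * `|v|) -> `|f| <= C.
Proof. exact: op_norm_le. Qed.

End BoundedLinear.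

Section HahnBanach.
Context {R : realType} (V : normedModType R).
Implicit Types (A B : set (V * R)) (x y v : V).

(* Graphs of linear functionals on subspaces, dominated by the norm. *)
Let dominated_graph A :=
  (forall a p q, A p -> A q -> A (a *: p.1 + q.1, a * p.2 + q.2)) /\
  (forall p, A p -> p.2 <= `|p.1|).

Let dominated_graph_fun A x r s : dominated_graph A ->
  A (x, r) -> A (x, s) -> r = s.
Proof.
move=> [lA dA] Ar As; apply/eqP; rewrite eq_le.
have := dA _ (lA (-1) _ _ As Ar); have := dA _ (lA (-1) _ _ Ar As).
rewrite /= scaleN1r addNr normr0 !mulN1r addrC subr_le0 => ->.
by rewrite addrC subr_le0 => ->.
Qed.

Let dominated_graph_extend A v0 : A !=set0 -> dominated_graph A ->
  exists c, dominated_graph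
    [set q | exists p t, [/\ A p, q.1 = p.1 + t *: v0 & q.2 = p.2 + t * c]].
Proof.
move=> [p0 Ap0] [lA dA].
pose S := [set s | exists p, A p /\ s = p.2 - `|p.1 - v0|].
have ub p q : A p -> A q -> p.2 - `|p.1 - v0| <= `|q.1 + v0| - q.2.
  move=> Ap Aq; rewrite lerBlDr addrAC lerBrDr [p.2 + _]addrC.
  have := dA _ (lA 1 _ _ Aq Ap); rewrite /= scale1r mul1r => /le_trans; apply.
  have -> : q.1 + p.1 = (q.1 + v0) + (p.1 - v0) by rewrite addrACA subrr addr0.
  exact: ler_normD.
have S0 : S !=set0 by exists (p0.2 - `|p0.1 - v0|), p0.
have lo p : A p -> p.2 - `|p.1 - v0| <= sup S.
  move=> Ap; apply: ub_le_sup; last by exists p.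
  by exists (`|p0.1 + v0| - p0.2) => _ [q [Aq ->]]; exact: ub.
have hi q : A q -> sup S <= `|q.1 + v0| - q.2.
  by move=> Aq; apply: ge_sup => // _ [p [Ap ->]]; exact: ub.
have AZ a p : A p -> A (a *: p.1, a * p.2).
  move=> Ap; have A0 : A (0, 0).
    have := lA (-1) _ _ Ap0 Ap0.
    by rewrite scaleN1r mulN1r !addNr.
  by have := lA a _ _ Ap A0; rewrite /= !addr0.
exists (sup S); split.
  move=> a _ _ [p [t [Ap -> ->]]] [q [u [Aq -> ->]]] /=.
  exists (a *: p.1 + q.1, a * p.2 + q.2), (a * t + u); split => /=.
  - exact: lA.
  - by rewrite scalerDr scalerA scalerDl addrACA.
  - by rewrite mulrDr mulrA [in RHS]mulrDl addrACA.
move=> q [p [t [Ap -> ->]]] /=.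
have [t0|t0|->] := ltgtP t 0; last by rewrite mul0r scale0r !addr0 dA.
- have nt0 : 0 < - t by rewrite oppr_gt0.
  have := lo _ (AZ (- t)^-1 _ Ap); rewrite /= lerBlDr -lerBlDl.
  rewrite -(ler_pM2l nt0) mulrBr mulrA divff ?gt_eqF// mul1r.
  rewrite -{2}(gtr0_norm nt0) -normrZ scalerBr scalerA divff ?gt_eqF//.
  by rewrite scale1r mulNr scaleNr !opprK.
- have := hi _ (AZ t^-1 _ Ap); rewrite /= lerBrDr addrC.
  rewrite -(ler_pM2l t0) mulrDr mulrA divff ?gt_eqF// mul1r.
  rewrite -{2}(gtr0_norm t0) -normrZ scalerDr scalerA divff ?gt_eqF//.
  by rewrite scale1r.
Qed.

Lemma norming_functional v : exists phi : blin V R,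
  `|phi| <= 1 /\ phi v = `|v|.
Proof.
pose G0 : set (V * R) := [set p | exists t, p = (t *: v, t * `|v|)].
have G0dom : dominated_graph G0.
  split=> [a _ _ [t ->] [u ->]|_ [t ->]]/=.
    by exists (a * t + u); rewrite scalerA -scalerDl mulrA mulrDl.
  by rewrite normrZ ler_wpM2r// ler_norm.
pose P A := A = set0 \/ G0 `<=` A /\ dominated_graph A.
have [A [PA Amax]] : exists A, P A /\ forall B, A `<` B -> ~ P B.
  apply: Zorn_bigcup => F FP Ftot.
  have [[A [FA A0]]|F0] := pselect (exists A, F A /\ A <> set0); last first.
    left; apply/seteqP; split=> // p [A FA Ap]; apply: F0; exists A; split=> //.
    by move=> A0; rewrite A0 in Ap.
  have FP' B p : F B -> B p -> dominated_graph B.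
    by move=> /FP[->//|[]].
  right; split.
    have [//|[G0A _]] := FP _ FA.
    by move=> p /G0A Ap; exists A.
  split=> [a p q [B FB Bp] [C FC Cq]|p [B FB Bp]]; last first.
    exact: (FP' _ _ FB Bp).2.
  have [BC|CB] := Ftot _ _ FB FC.
    by exists C => //; apply: (FP' _ _ FC Cq).1 => //; exact: BC.
  by exists B => //; apply: (FP' _ _ FB Bp).1 => //; exact: CB.
have {PA} [G0A dA] : G0 `<=` A /\ dominated_graph A.
  case: PA => // A0; exfalso; apply: (Amax G0); last by right; split.
  rewrite A0; split; first by move=> _ [].
  by move=> /(_ (0 *: v, 0 * `|v|)); apply; exists 0.
have Atot x : exists r, A (x, r).
  apply: contrapT => /forallNP nA.
  have A0 : A !=set0 by exists (0 *: v, 0 * `|v|); apply: G0A; exists 0.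
  have [c cP] := dominated_graph_extend x A0 dA.
  move: cP; set B := [set q | _] => cP.
  have AB : A `<=` B.
    by move=> p Ap; exists p, 0; rewrite scale0r mul0r !addr0.
  apply: (Amax B); last by right; split=> //; apply: subset_trans AB.
  split=> //; move=> BA; apply: (nA c); apply: BA.
  exists (0 *: v, 0 * `|v|), 1; split => /=.
  - by apply: G0A; exists 0.
  - by rewrite scale0r add0r scale1r.
  - by rewrite mul0r add0r mul1r.
pose phi x := sval (cid (Atot x)).
have phiP x : A (x, phi x) by rewrite /phi; case: cid.
have phiE x r : A (x, r) -> phi x = r.
  by move=> Axr; apply: (dominated_graph_fun dA (phiP x) Axr).
have lphi : linear phi.
  by move=> a x y; apply: phiE; exact: (dA.1 a _ _ (phiP x) (phiP y)).
have bphi x : `|phi x| <= 1 * `|x|.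
  rewrite mul1r ler_norml; apply/andP; split; last exact: dA.2 (phiP x).
  rewrite lerNl -normrN; apply: dA.2 (- x, - phi x) _ => /=.
  have := dA.1 (-1 - 1) _ _ (phiP x) (phiP x).
  by rewrite /= scalerBl mulrBl !scaleN1r scale1r !mulN1r mul1r !subrK.
have phi_blin : phi \in @blin_pred R V R by apply/mem_set; split=> //; exists 1.
exists (mkBlin phi_blin); split.
  exact: blin_norm_le.
by apply: phiE; apply: G0A; exists 1; rewrite scale1r mul1r.
Qed.

Lemma dual_separates x y : (forall phi : blin V R, phi x = phi y) -> x = y.
Proof.
move=> xy; apply/eqP; rewrite -subr_eq0 -normr_eq0.
have [phi [_ <-]] := norming_functional (x - y).
by rewrite linearB/= xy subrr.
Qed.

Lemma dual_norm_le x C :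
  (forall phi : blin V R, `|phi| <= 1 -> `|phi x| <= C) -> `|x| <= C.
Proof.
have [phi [phi1 phix]] := norming_functional x.
by move=> /(_ _ phi1); rewrite phix normr_id.
Qed.

End HahnBanach.

Section LinearSpan.
Context {R : realType}.

Definition lspan (V : lmodType R) (A : set V) : set V :=
  [set v | exists n (a : 'I_n -> R) (w : 'I_n -> V),
    (forall i, A (w i)) /\ v = \sum_(i < n) a i *: w i].

Lemma lspan_sub (V : lmodType R) (A : set V) : A `<=` lspan A.
Proof.
move=> v Av; exists 1%N, (fun=> 1), (fun=> v); split=> //.
by rewrite big_ord1 scale1r.
Qed.

Lemma lspan_lin (V : lmodType R) (A : set V) a u v :
  lspan A u -> lspan A v -> lspan A (a *: u + v).
Proof.
move=> [m [b [w [Aw ->]]]] [n [c [z [Az ->]]]].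
exists (m + n)%N,
  (fun i => match fintype.split i with inl j => a * b j | inr j => c j end),
  (fun i => match fintype.split i with inl j => w j | inr j => z j end).
split=> [i|]; first by case: fintype.split.
rewrite big_split_ord/= scaler_sumr; congr (_ + _); apply: eq_bigr => i _.
  by rewrite (unsplitK (inl i)) scalerA.
by rewrite (unsplitK (inr i)).
Qed.

Lemma lspan0 (V : lmodType R) (A : set V) : lspan A 0.
Proof. by exists 0%N, (fun=> 0), (fun=> 0); split; [case|rewrite big_ord0]. Qed.

Lemma lspan_ind (V : lmodType R) (A P : set V) : P 0 ->
  (forall a u v, A u -> P v -> P (a *: u + v)) -> lspan A `<=` P.
Proof.
move=> P0 PD _ [n [a [w [Aw ->]]]]; elim/big_rec : _ => // i v _.
exact: PD.
Qed.

Lemma closure_normP (V : normedModType R) (A : set V) v :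
  closure A v <-> forall e, 0 < e -> exists2 u, A u & `|v - u| < e.
Proof.
split=> [cAv e e0|H B /nbhs_ballP[e/= e0 eB]].
  have [u [Au]] := cAv _ (nbhsx_ballx v e e0).
  by rewrite -ball_normE; exists u.
have [u Au vu] := H _ e0.
by exists u; split=> //; apply: eB; rewrite -ball_normE.
Qed.

End LinearSpan.

Section LipschitzFree.
Context {R : realType} {X : metricType R} (o : X).
Local Notation dual V := (@blin R V R).
Local Notation Xsharp := (Lip0 o R).

Lemma lip_eval_blin x y :
  (fun f : Xsharp => f x - f y) \in @blin_pred R Xsharp R.
Proof.
apply/mem_set; split=> [a f g|]; first by rewrite opprD addrACA -mulrBr.
by exists (mdist x y) => f; rewrite mulrC lip0_normP.
Qed.

Definition lip_eval x y : dual Xsharp := mkBlin (lip_eval_blin x y).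

Definition free_set : set (dual Xsharp) :=
  closure (lspan [set lip_eval xy.1 xy.2 | xy in [set: X * X]]).

Definition free_pred : {pred dual Xsharp} := mem free_set.

Record lipfree := mkLipfree {
  lipfree_val : dual Xsharp ; _ : lipfree_val \in free_pred }.

HB.instance Definition _ := [isSub for lipfree_val].
HB.instance Definition _ := [Choice of lipfree by <:].

Lemma free_submod : submod_closed free_pred.
Proof.
split=> [|a u v /set_mem/closure_normP Hu /set_mem/closure_normP Hv].
  by apply/mem_set; apply: subset_closure; exact: lspan0.
apply/mem_set/closure_normP => e e0.
have d0 : 0 < (e / 2) / (`|a| + 1).
  by rewrite !divr_gt0// ltr_wpDl.
have [u' Au' uu'] := Hu _ d0.
have [v' Av' vv'] := Hv _ (divr_gt0 e0 (ltr0n R 2)).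
exists (a *: u' + v'); first exact: lspan_lin.
rewrite opprD addrACA -scalerBr (le_lt_trans (ler_normD _ _))// normrZ.
rewrite [ltRHS]splitr ler_ltD//.
have : (`|a| + 1) * `|u - u'| <= e / 2.
  by rewrite mulrC -ler_pdivlMr ?ltW// ltr_wpDl.
by apply: le_trans; rewrite ler_wpM2r// lerDl.
Qed.

HB.instance Definition _ := GRing.isSubmodClosed.Build R (dual Xsharp)
  free_pred free_submod.
HB.instance Definition _ := [SubChoice_isSubLmodule of lipfree by <:].

Definition free_norm (m : lipfree) : R := `|val m|.

Lemma free_normD m n : free_norm (m + n) <= free_norm m + free_norm n.
Proof. exact: ler_normD. Qed.

Lemma free_normZ a m : free_norm (a *: m) = `|a| * free_norm m.
Proof. exact: normrZ. Qed.

Lemma free_norm_eq0 m : free_norm m = 0 -> m = 0.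
Proof. by move=> m0; apply/val_inj/normr0_eq0. Qed.

HB.instance Definition _ := @Lmodule_isNormed.Build R lipfree free_norm
  free_normD free_normZ free_norm_eq0.

Lemma free_delta_subproof x y : lip_eval x y \in free_pred.
Proof.
apply/mem_set/subset_closure/lspan_sub.
by exists (x, y).
Qed.

Definition free_delta x y : lipfree := mkLipfree (free_delta_subproof x y).

Lemma free_normE (m : lipfree) : `|m| = `|lipfree_val m|.
Proof. by []. Qed.

Lemma free_deltaB x y : free_delta x y = free_delta x o - free_delta y o.
Proof.
apply/val_inj/val_inj/funext => f /=.
transitivity ((f x - f o) - (f y - f o)); last by [].
by rewrite lip0_base !subr0.
Qed.

Lemma lipfree_ind (P : set lipfree) : closed P -> P 0 ->
  (forall a x y m, P m -> P (a *: free_delta x y + m)) -> forall m, P m.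
Proof.
move=> cP P0 PD m; apply/cP/closure_normP => e e0.
have /set_mem/closure_normP/(_ _ e0)[u] := valP m.
move=> su mu; suff [m' [Pm' m'u]] : exists m', P m' /\ val m' = u.
  by exists m' => //; rewrite free_normE -m'u in mu *.
move: u su {mu}; apply: lspan_ind; first by exists 0.
move=> a _ v [xy _ <-] [m' [Pm' <-]].
exists (a *: free_delta xy.1 xy.2 + m'); split=> //; exact: PD.
Qed.

Context {E : completeNormedModType R}.

Lemma blin_lipfree_eq (S1 S2 : blin lipfree E) :
  (forall x, S1 (free_delta x o) = S2 (free_delta x o)) -> S1 = S2.
Proof.
move=> S12; apply/val_inj/funext => m /=; move: m.
apply: lipfree_ind => [m /closure_normP Hm|/=|a x y m/= Sm].
- apply/eqP; rewrite -subr_eq0 -normr_le0; apply/ler_addgt0Pl => e e0.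
  rewrite addr0; have [m' Sm' mm'] := Hm _ (divr_gt0 e0 (ltr_wpDl (normr_ge0 (S1 - S2)) ltr01)).
  have -> : S1 m - S2 m = (S1 - S2) (m - m').
    rewrite -[RHS]/(S1 (m - m') - S2 (m - m')) (linearB S1) (linearB S2)/=.
    by rewrite (Sm' : S1 m' = S2 m') opprB addrA subrK.
  rewrite (le_trans (blin_normP _ _))//.
  rewrite (@le_trans _ _ ((`|S1 - S2| + 1) * `|m - m'|))//.
    by rewrite ler_wpM2r// lerDl.
  by rewrite mulrC -ler_pdivlMr ?ltW// ltr_wpDl.
- by rewrite !linear0.
- by rewrite !linearP/= Sm free_deltaB !linearB/= !S12.
Qed.

Lemma lip0_dual_comp (T : Lip0 o E) (phi : dual E) :
  (fun x => phi (T x)) \in @lip0_pred R X o R.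
Proof.
apply/mem_set; split; first by rewrite lip0_base linear0.
exists (`|phi| * `|T|) => -[x y] /=; rewrite -linearB/=.
by rewrite (le_trans (blin_normP _ _))// -mulrA ler_wpM2l// lip0_normP.
Qed.

Definition lip0_adjoint (T : Lip0 o E) (phi : dual E) : Xsharp :=
  mkLip0 (lip0_dual_comp T phi).

Lemma lip0_adjoint_norm T phi : `|lip0_adjoint T phi| <= `|T| * `|phi|.
Proof.
apply: lip0_norm_le => [|x y]; first by rewrite mulr_ge0.
rewrite /= -linearB/= (le_trans (blin_normP _ _))//.
by rewrite [leRHS]mulrAC mulrC ler_wpM2r// lip0_normP.
Qed.

Lemma lip0_extension T (m : lipfree) : exists e : E,
  forall phi : dual E, phi e = val m (lip0_adjoint T phi).
Proof.
move: m; apply: lipfree_ind => [m /closure_normP Hm||a x y m [e He]].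
- have L0 : 0 <= `|T| by [].
  have u_ (k : nat) : {me : lipfree * E | (forall phi : dual E,
      phi me.2 = val me.1 (lip0_adjoint T phi)) /\ `|m - me.1| < k.+1%:R^-1}.
    apply/cid; have k0 : 0 < k.+1%:R^-1 :> R by rewrite invr_gt0.
    by have [m' [e' H] H'] := Hm _ k0; exists (m', e').
  pose u k := (sval (u_ k)).1; pose e k := (sval (u_ k)).2.
  have uE k (phi : dual E) : phi (e k) = val (u k) (lip0_adjoint T phi).
    by rewrite /u /e; case: (u_ k) => -[? ?] [].
  have mu k : `|m - u k| < k.+1%:R^-1.
    by rewrite /u; case: (u_ k) => -[? ?] [].
  have eB k l : `|e k - e l| <= `|T| * `|u k - u l|.
    apply: dual_norm_le => phi phi1; rewrite linearB/= !uE.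
    rewrite -[X in `|X|]/(val (u k - u l) (lip0_adjoint T phi)).
    rewrite (le_trans (blin_normP _ _))// -free_normE mulrC ler_wpM2r//.
    by rewrite (le_trans (lip0_adjoint_norm _ _))// ler_piMr.
  have uB k l n : (n <= k)%N -> (n <= l)%N -> `|u k - u l| <= 2 / n.+1%:R.
    move=> nk nl; rewrite -[u k](subrK m) -addrA (le_trans (ler_normD _ _))//.
    have H j : (n <= j)%N -> `|m - u j| <= n.+1%:R^-1.
      by move=> nj; rewrite (le_trans (ltW (mu _)))// lef_pV2 ?posrE// ler_nat.
    rewrite [leRHS]mulr_natl [leRHS]mulr2n; apply: lerD; last exact: H.
    by rewrite distrC; exact: H.
  have ce : cvg (e @ \oo).
    apply/cauchy_cvgP/cauchy_exP => eps eps0.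
    have [n Hn] : exists n : nat, `|T| * 2 / eps < n.+1%:R.
      exists (Num.truncn (`|T| * 2 / eps)).
      exact: truncnS_gt.
    exists (e n); exists n => // k /= nk; rewrite -ball_normE/=.
    rewrite (le_lt_trans (eB _ _))//.
    rewrite (le_lt_trans (ler_wpM2l L0 (uB _ _ n _ _)))//.
    by rewrite mulrA ltr_pdivrMr// [ltRHS]mulrC -ltr_pdivrMr.
  exists (lim (e @ \oo)) => phi; apply/eqP; rewrite -subr_eq0 -normr_le0.
  apply/ler_addgt0Pl => eps eps0; rewrite addr0.
  pose K := `|phi| + `|lip0_adjoint T phi| + 1.
  have K0 : 0 < K by rewrite ltr_wpDl// addr_ge0.
  pose d := eps / K / 2; have d0 : 0 < d by rewrite !divr_gt0.
  have [N _ HN] : \forall k \near \oo, `|lim (e @ \oo) - e k| < d.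
    by move/cvgrPdist_lt : ce; apply.
  pose k := maxn N (Num.truncn d^-1).
  have K1 : `|m - u k| <= d.
    rewrite (le_trans (ltW (mu k)))// invf_ple ?posrE//.
    by rewrite (le_trans (ltW (truncnS_gt _)))// ler_nat ltnS leq_maxr.
  have K2 : `|lim (e @ \oo) - e k| <= d.
    by apply/ltW/HN; rewrite /= leq_maxl.
  have -> : phi (lim (e @ \oo)) - val m (lip0_adjoint T phi) =
      phi (lim (e @ \oo) - e k) - val (m - u k) (lip0_adjoint T phi).
    transitivity (phi (lim (e @ \oo)) - phi (e k) -
        (val m (lip0_adjoint T phi) - val (u k) (lip0_adjoint T phi))).
      by rewrite uE opprB addrA subrK.
    by rewrite (linearB phi).
  rewrite (le_trans (ler_normB _ _))//.
  rewrite (@le_trans _ _ (`|phi| * d + d * `|lip0_adjoint T phi|))//.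
    rewrite lerD// (le_trans (blin_normP _ _))//; first by rewrite ler_wpM2l.
    by rewrite ler_wpM2r.
  rewrite [X in _ + X]mulrC -mulrDl (@le_trans _ _ (K * d))//.
    by rewrite ler_wpM2r ?lerDl// ltW.
  rewrite /d mulrA [K * _]mulrC divfK ?gt_eqF//.
  by rewrite ler_pdivrMr// ler_peMr ?ltW// ltr1n.
- by exists 0 => phi; rewrite linear0.
- exists (a *: (T x - T y) + e) => phi.
  by rewrite linearP/= He linearB.
Qed.

Lemma linearization_exists (T : Lip0 o E) :
  exists S : blin lipfree E, forall x, S (free_delta x o) = T x.
Proof.
pose S m := sval (cid (lip0_extension T m)).
have SE m (phi : dual E) : phi (S m) = val m (lip0_adjoint T phi).
  by rewrite /S; case: cid.
have Sb : S \in @blin_pred R lipfree E.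
  apply/mem_set; split=> [a m n|].
    by apply: dual_separates => phi; rewrite linearP/= !SE.
  exists (`|T|) => m; apply: dual_norm_le => phi phi1.
  rewrite SE (le_trans (blin_normP _ _))// -free_normE mulrC ler_wpM2r//.
  by rewrite (le_trans (lip0_adjoint_norm _ _))// ler_piMr.
exists (mkBlin Sb) => x; apply: dual_separates => phi /=.
rewrite SE -[LHS]/(phi (T x) - phi (T o)).
by rewrite lip0_base linear0 subr0.
Qed.

(* [linearizationE] and [linearization_unique] below are the universal property
   characterizing this map. *)
Definition linearization (T : Lip0 o E) : blin lipfree E :=
  sval (cid (linearization_exists T)).

Lemma linearizationE (T : Lip0 o E) x : linearization T (free_delta x o) = T x.
Proof. by rewrite /linearization; case: cid. Qed.

Lemma linearization_unique (T : Lip0 o E) (S : blin lipfree E) :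
  (forall x, S (free_delta x o) = T x) -> S = linearization T.
Proof. by move=> ST; apply: blin_lipfree_eq => x; rewrite ST linearizationE. Qed.

End LipschitzFree.

Section WeakNorm.
Context {R : realType}.
Local Notation dual V := (@blin R V R).

(* The value at [-oo] is junk: only exponents in [1, +oo] are used. *)
Definition lp_norm n (p : \bar R) (a : 'I_n -> R) : R :=
  match p with
  | r%:E => (\sum_(i < n) `|a i| `^ r) `^ r^-1
  | +oo%E => \big[Num.max/0]_(i < n) `|a i|
  | -oo%E => 0
  end.

Definition weak_lp_norm (V : normedModType R) n (p : \bar R)
    (e : 'I_n -> V) : R :=
  sup [set lp_norm p (fun i => phi (e i)) |
        phi in [set phi : dual V | `|phi| <= 1]].

End WeakNorm.

Section CohenNuclear.
Context {R : realType}.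
Local Notation dual V := (@blin R V R).
Variables (p : \bar R) (V W : normedModType R).

Definition nuclear_bound (S : V -> W) (C : R) : Prop :=
  forall n (x : 'I_n -> V) (y : 'I_n -> dual W),
    \sum_(i < n) `|y i (S (x i))| <=
      C * weak_lp_norm p x * weak_lp_norm (hoelder_conjugate p) y.

(* The operator is only required to be linear, not bounded: boundedness
   follows from the inequality with [n = 1]. *)
Definition nuclear : set (V -> W) :=
  [set S | linear S /\ exists C, 0 < C /\ nuclear_bound S C].

(* An infimum over [C > 0], so that it is 0 for [S = 0]; otherwise it is the
   least admissible constant. *)
Definition nuclear_norm (S : V -> W) : R :=
  inf [set C | 0 < C /\ nuclear_bound S C].

End CohenNuclear.

Section StrictlyLipschitzNuclear.
Context {R : realType} {X : metricType R} (o : X) (E : normedModType R).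
Local Notation dual V := (@blin R V R).

(* The algebraic tensor product of two vector spaces, realized inside the
   linear functionals on the space of all bilinear forms. *)
Definition tens (V W : lmodType R) (v : V) (w : W) :
  {bilinear V -> W -> R | *%R & *%R} -> R := fun B => B v w.

(* The elementary Lipschitz tensor [delta_(x,y) \boxtimes s]. *)
Definition lip_tens (x y : X) (s : dual E) : Lip0 o (dual (dual E)) -> R :=
  fun f => (f x - f y) s.

(* Any representation of [u] as a sum of elementary tensors may be used: the
   sum of the [tens (free_delta o (x k) (y k)) (s k)] depends on [u] only. When
   [u] is no such sum (outside the Lipschitz tensor product) the set is empty
   and the value is junk. *)
Definition wSL (p : \bar R) (u : Lip0 o (dual (dual E)) -> R) : R :=
  inf [set c | exists n (m : 'I_n -> lipfree o) (e : 'I_n -> dual E)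
                      l (x y : 'I_l -> X) (s : 'I_l -> dual E),
    [/\ u = \sum_(k < l) lip_tens (x k) (y k) (s k),
        \sum_(i < n) tens (m i) (e i) =
          \sum_(k < l) tens (free_delta o (x k) (y k)) (s k) &
        c = weak_lp_norm p m * weak_lp_norm (hoelder_conjugate p) e]].

Definition sl_nuclear_bound (p : \bar R) (T : Lip0 o E) (C : R) : Prop :=
  forall l (x y : 'I_l -> X) (s : 'I_l -> dual E),
    `|\sum_(k < l) s k (T (x k) - T (y k))| <=
      C * wSL p (\sum_(k < l) lip_tens (x k) (y k) (s k)).

Definition sl_nuclear (p : \bar R) : set (Lip0 o E) :=
  [set T | exists C, 0 < C /\ sl_nuclear_bound p T C].

Definition sl_nuclear_norm (p : \bar R) (T : Lip0 o E) : R :=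
  inf [set C | 0 < C /\ sl_nuclear_bound p T C].

End StrictlyLipschitzNuclear.

(* Main.v *)
(* A function [f] in [Lip0 o E^**] of the form [x |-> (phi |-> phi (T x))] shows
   that the pairing of [T] with a Lipschitz tensor [u] depends on [u] only, and
   it equals [\sum_i e_i (That m_i)] for every representation
   [\sum_i m_i \otimes e_i] of [u]. Hence a Cohen bound for [That] with constant
   [C] gives the strict bound for [T] with the same [C]. Conversely, the strict
   bound gives the Cohen bound whenever the [m_i] are finite combinations of
   [delta_(x,y)], after absorbing signs into the [e_i]; these combinations are
   dense in the free space and the weak norm of [(m_i)] is continuous by
   Minkowski's inequality, so the bound passes to all [m_i]. The two sets of
   admissible constants being equal, so are the norms. Surjectivity holds
   because a Cohen bound with [n = 1] forces boundedness. *)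
Require Import Defs.
From HB Require Import structures.
From mathcomp Require Import all_boot all_order all_algebra.
From mathcomp Require Import all_classical all_reals all_analysis.
From mathcomp Require Import ring.
Import Order.TTheory GRing.Theory Num.Theory.
Import numFieldNormedType.Exports.
Local Open Scope classical_set_scope.
Local Open Scope ring_scope.

(** * Finite sequences of reals: monotonicity, homogeneity and Minkowski's inequality *)

Section FiniteLpNorm.
Context {R : realType}.

Lemma eq_lp_norm n (p : \bar R) (a b : 'I_n -> R) :
  (forall i, `|a i| = `|b i|) -> lp_norm p a = lp_norm p b.
Proof.
move=> ab; case: p => [r| |] /=; last by [].
- by congr (_ `^ _); apply: eq_bigr => i _; rewrite ab.
- by apply: eq_bigr => i _; rewrite ab.
Qed.

Lemma lp_norm_ge0 n (p : \bar R) (a : 'I_n -> R) : 0 <= lp_norm p a.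
Proof.
by case: p => [r| |] /=; [exact: powR_ge0|exact: bigmax_ge_id|].
Qed.

Lemma le_lp_norm n (p : \bar R) (a b : 'I_n -> R) : (0 <= p)%E ->
  (forall i, `|a i| <= `|b i|) -> lp_norm p a <= lp_norm p b.
Proof.
case: p => [r| |] p0 ab; rewrite /lp_norm; last by [].
- rewrite lee_fin in p0.
  apply: ge0_ler_powR; rewrite ?invr_ge0 ?nnegrE ?sumr_ge0 ?powR_ge0//.
  apply: ler_sum => i _; exact: ge0_ler_powR.
- apply: bigmax_le => [|i _]; first exact: bigmax_ge_id.
  exact: (bigmax_sup i).
Qed.

Lemma lp_normZ n (p : \bar R) c (a : 'I_n -> R) : (0 < p)%E ->
  lp_norm p (fun i => c * a i) <= `|c| * lp_norm p a.
Proof.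
case: p => [r| |] p0; rewrite /lp_norm; last by [].
- rewrite lte_fin in p0.
  under eq_bigr do rewrite normrM powRM//.
  rewrite -mulr_sumr powRM ?powR_ge0 ?sumr_ge0//.
  by rewrite -powRrM divff ?gt_eqF// powRr1.
- apply: bigmax_le => [|i _]; first by rewrite mulr_ge0// bigmax_ge_id.
  by rewrite normrM ler_wpM2l// (bigmax_sup i).
Qed.

Lemma lp_norm_ord1 (p : \bar R) (a : 'I_1 -> R) : (0 < p)%E ->
  lp_norm p a = `|a ord0|.
Proof.
case: p => [r| |] p0; rewrite /lp_norm; last by [].
- by rewrite big_ord_recl big_ord0 addr0 -powRrM divff ?powRr1 ?gt_eqF.
- by rewrite big_ord_recl big_ord0; apply/max_idPl; exact: normr_ge0.
Qed.

(** Monotonicity and homogeneity of powers turn a bound on the norm into a bound by 1 on a sum of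
    [r]-th powers, where convexity can be used term by term. *)
Lemma powR_sum_root_le n (r s : R) (a : 'I_n -> R) : 0 < r -> 0 < s ->
  ((\sum_(i < n) `|a i| `^ r) `^ r^-1 <= s) =
  (\sum_(i < n) (`|a i| / s) `^ r <= 1).
Proof.
move=> r0 s0.
have s_ge0 := ltW s0; have r_ge0 := ltW r0.
have S0 : 0 <= \sum_(i < n) `|a i| `^ r by rewrite sumr_ge0.
under [in RHS]eq_bigr do rewrite powRM ?invr_ge0//.
rewrite -mulr_suml -[s^-1]powR_inv1// -powRrM mulN1r powRN.
rewrite ler_pdivrMr ?powR_gt0// mul1r.
apply/idP/idP => [|]H.
  have : ((\sum_(i < n) `|a i| `^ r) `^ r^-1) `^ r <= s `^ r.
    by apply: ge0_ler_powR; rewrite ?nnegrE ?powR_ge0.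
  by rewrite -powRrM mulVf ?gt_eqF// powRr1.
have : (\sum_(i < n) `|a i| `^ r) `^ r^-1 <= (s `^ r) `^ r^-1.
  by apply: ge0_ler_powR; rewrite ?nnegrE ?invr_ge0 ?powR_ge0.
by rewrite -powRrM divff ?gt_eqF// powRr1.
Qed.

(* Convexity of [t |-> t ^ r] is applied to [|a i| / s] and [|b i| / u], with
   [s] and [u] slightly larger than the norms, to avoid dividing by zero. *)
Lemma lp_normD n (p : \bar R) (a b : 'I_n -> R) : (1 <= p)%E ->
  lp_norm p (fun i => a i + b i) <= lp_norm p a + lp_norm p b.
Proof.
case: p => [r| |] p1; rewrite /lp_norm; last by []; last first.
  apply: bigmax_le => [|i _]; first by rewrite addr_ge0// bigmax_ge_id.
  by rewrite (le_trans (ler_normD _ _))// lerD// (bigmax_sup i).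
rewrite lee_fin in p1; have r0 : 0 < r := lt_le_trans ltr01 p1.
(* The two norms are generalized to [A] and [B], of which only nonnegativity and the upper bounds
   [HA], [HB] are kept. *)
have := powR_ge0 (\sum_(i < n) `|a i| `^ r) r^-1.
move: (lexx ((\sum_(i < n) `|a i| `^ r) `^ r^-1)).
move: {2 3 4}((\sum_(i < n) `|a i| `^ r) `^ r^-1) => A HA A0.
have := powR_ge0 (\sum_(i < n) `|b i| `^ r) r^-1.
move: (lexx ((\sum_(i < n) `|b i| `^ r) `^ r^-1)).
move: {2 3 4}((\sum_(i < n) `|b i| `^ r) `^ r^-1) => B HB B0.
apply/ler_addgt0Pl => e e0.
pose s := A + e / 2; pose u := B + e / 2.
have s0 : 0 < s by rewrite ltr_wpDl// divr_gt0.
have u0 : 0 < u by rewrite ltr_wpDl// divr_gt0.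
have As : \sum_(i < n) (`|a i| / s) `^ r <= 1.
  by rewrite -powR_sum_root_le// (le_trans HA)// lerDl divr_ge0// ltW.
have Bu : \sum_(i < n) (`|b i| / u) `^ r <= 1.
  by rewrite -powR_sum_root_le// (le_trans HB)// lerDl divr_ge0// ltW.
have -> : e + (A + B) = s + u by rewrite /s /u addrACA -splitr addrC.
have su0 : 0 < s + u by exact: addr_gt0.
rewrite powR_sum_root_le//.
(* With this weight the convex combination of [|a i| / s] and [|b i| / u] is
   [(|a i| + |b i|) / (s + u)]. *)
pose t := s / (s + u).
have t0 : 0 <= t by rewrite divr_ge0// ltW.
have t1 : t <= 1 by rewrite ler_pdivrMr// mul1r lerDl ltW.
have tE : 1 - t = u / (s + u).
  by rewrite /t; field; rewrite gt_eqF.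
apply: (@le_trans _ _ (\sum_(i < n)
    (t * (`|a i| / s) `^ r + (1 - t) * (`|b i| / u) `^ r))).
  apply: ler_sum => i _.
  have Ha : 0 <= `|a i| / s by rewrite divr_ge0// ltW.
  have Hb : 0 <= `|b i| / u by rewrite divr_ge0// ltW.
  have := @convex_powR R r p1 (Itv01 t0 t1) (`|a i| / s) (`|b i| / u).
  rewrite !inE /= !in_itv /= !andbT => /(_ Ha Hb).
  rewrite convRE [X in X `^ _ <= _]convRE /=; apply: le_trans.
  have -> : t * (`|a i| / s) + (1 - t) * (`|b i| / u) =
      (`|a i| + `|b i|) / (s + u).
    by rewrite tE /t; field; rewrite !gt_eqF.
  have su_ge0 := ltW su0; apply: ge0_ler_powR; rewrite ?nnegrE ?divr_ge0//.
  - exact: ltW.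
  - by rewrite ler_wpM2r ?invr_ge0// ler_normD.
rewrite big_split/= -!mulr_sumr.
rewrite -[leRHS](subrK t) addrC lerD//.
  by rewrite ler_piMr// subr_ge0.
by rewrite ler_piMr.
Qed.

End FiniteLpNorm.

(** * Weak norms of finite sequences in a normed space *)

Section WeakLpNorm.
Context {R : realType} {V : normedModType R}.

(** The set under [sup] is bounded above by the [lp_norm] of the norms of the [e i], so [sup] is a
    true supremum here. *)
Lemma lp_norm_le_weak n (p : \bar R) (e : 'I_n -> V) (phi : blin V R) :
  (0 <= p)%E -> `|phi| <= 1 ->
  lp_norm p (fun i => phi (e i)) <= weak_lp_norm p e.
Proof.
move=> p0 phi1; apply: ub_le_sup; last by exists phi.
exists (lp_norm p (fun i => `|e i|)) => _ [psi /= psi1 <-].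
apply: le_lp_norm => // i; rewrite normr_id (le_trans (blin_normP _ _))//.
by rewrite ler_piMl.
Qed.

Lemma weak_lp_norm_le n (p : \bar R) (e : 'I_n -> V) C :
  (forall phi : blin V R, `|phi| <= 1 ->
    lp_norm p (fun i => phi (e i)) <= C) -> weak_lp_norm p e <= C.
Proof.
move=> H; apply: ge_sup => [|_ [phi /= phi1 <-]]; last exact: H.
(* The zero functional shows that the set under [sup] is nonempty. *)
by exists (lp_norm p (fun i => (0 : blin V R) (e i))), 0 => //=; rewrite normr0.
Qed.

Lemma weak_lp_norm_ge0 n (p : \bar R) (e : 'I_n -> V) : 0 <= weak_lp_norm p e.
Proof.
rewrite /weak_lp_norm; set S := [set _ | _ in _].
(* When there is no supremum, [sup] is 0 by default. *)
have [[S0 Sub]|] := pselect (has_sup S); last by move=> nS; rewrite sup_out.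
case: S0 => x Sx; apply: le_trans (ub_le_sup Sub Sx).
by case: Sx => phi _ <-; exact: lp_norm_ge0.
Qed.

Lemma eq_weak_lp_norm n (p : \bar R) (e f : 'I_n -> V) :
  (forall (phi : blin V R) i, `|phi (e i)| = `|phi (f i)|) ->
  weak_lp_norm p e = weak_lp_norm p f.
Proof.
move=> ef; congr (sup _); apply: eq_imagel => phi _.
by apply: eq_lp_norm => i.
Qed.

(** Under each functional of norm at most 1, Minkowski's inequality splits [f] as [e + (f - e)], and
    the second term is dominated by the constant family [d]. *)
Lemma weak_lp_norm_perturb n (p : \bar R) (e f : 'I_n -> V) (d : R) :
  (1 <= p)%E -> 0 <= d -> (forall i, `|f i - e i| <= d) ->
  weak_lp_norm p f <= weak_lp_norm p e + d * @lp_norm R n p (fun=> 1).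
Proof.
move=> p1 d0 ed; have p0 : (0 < p)%E := lt_le_trans lte01 p1.
apply: weak_lp_norm_le => phi phi1.
have -> : (fun i => phi (f i)) = (fun i => phi (e i) + phi (f i - e i)).
  by apply/funext => i; rewrite -linearD/= addrC subrK.
apply: (le_trans (lp_normD n p _ _ p1)); apply: lerD.
  by apply: lp_norm_le_weak => //; exact: ltW.
apply: (@le_trans _ _ (@lp_norm R n p (fun=> d * 1))).
  apply: le_lp_norm => [|i]; first exact: ltW.
  rewrite mulr1 (ger0_norm d0) (le_trans (blin_normP _ _))//.
  by rewrite (le_trans _ (ed i))// ler_piMl.
by apply: (le_trans (lp_normZ n p d _ p0)); rewrite ger0_norm.
Qed.

Lemma weak_lp_norm_ord1 (p : \bar R) (e : 'I_1 -> V) :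
  (0 < p)%E -> weak_lp_norm p e <= `|e ord0|.
Proof.
move=> p0; apply: weak_lp_norm_le => phi phi1.
by rewrite lp_norm_ord1// (le_trans (blin_normP _ _))// ler_piMl.
Qed.

End WeakLpNorm.

(** * Boundedness from Cohen's inequality *)

Section NuclearBounded.
Context {R : realType} {V W : normedModType R}.

(** For [n = 1] the weak norms are at most the norms of the vector and of the functional;
    Hahn-Banach then recovers the norm of [S v]. *)
Lemma nuclear_bound_norm (p : \bar R) (S : V -> W) C : (1 <= p)%E -> 0 <= C ->
  nuclear_bound p S C -> forall v, `|S v| <= C * `|v|.
Proof.
move=> p1 C0 SC v; apply: dual_norm_le => phi phi1.
have := SC 1%N (fun=> v) (fun=> phi); rewrite big_ord1 => /le_trans; apply.
rewrite -[leRHS]mulr1; apply: ler_pM.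
- by rewrite mulr_ge0// weak_lp_norm_ge0.
- exact: weak_lp_norm_ge0.
- by rewrite ler_wpM2l// weak_lp_norm_ord1// (lt_le_trans lte01).
- apply: (le_trans _ phi1); apply: weak_lp_norm_ord1.
  exact: (lt_le_trans lte01 (hoelder_conj_ge1 p1)).
Qed.

End NuclearBounded.

(** * Algebraic tensors and the pairing induced by an operator *)

Section Tensors.
Context {R : realType}.

Section Elementary.
Context {V W : lmodType R}.

Lemma tensDl (u v : V) (w : W) : tens (u + v) w = tens u w + tens v w.
Proof. by apply/funext => B; rewrite /tens linearDl. Qed.

Lemma tensZ a (v : V) (w : W) : tens (a *: v) w = tens v (a *: w).
Proof. by apply/funext => B; rewrite /tens linearZl_LR linearZr_LR. Qed.

Lemma tensZr a (v : V) (w : W) : tens v (a *: w) = a *: tens v w.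
Proof. by apply/funext => B; rewrite /tens linearZr_LR. Qed.

Lemma tens0l (w : W) : tens (0 : V) w = 0.
Proof. by apply/funext => B; rewrite /tens linear0l. Qed.

End Elementary.

Section DualPairing.
Context {V W : normedModType R} (S : blin V W).

(** Made an instance of [{bilinear}] below, so that sums of [tens] can be evaluated at it. *)
Definition dual_pairing (v : V) (phi : blin W R) : R := phi (S v).

Lemma dual_pairing_bilinear :
  bilinear_for *%R *%R dual_pairing.
Proof.
split=> [phi|v] a u u'; rewrite /dual_pairing; last by [].
by rewrite !linearP.
Qed.

HB.instance Definition _ := bilinear_isBilinear.Build R V (blin W R) R *%R *%R
  dual_pairing dual_pairing_bilinear.

End DualPairing.
End Tensors.

(** * Density of molecules and pairings with Lipschitz tensors *)

Section LipschitzTensors.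
Context {R : realType} {X : metricType R} {o : X} {E : completeNormedModType R}.
Implicit Types T : Lip0 o E.

Let deltas : set (lipfree o) :=
  [set free_delta o xy.1 xy.2 | xy in [set: X * X]].

(** [free_set] is a closure in the dual of the Lipschitz functions; [lipfree_ind] transfers the
    density to the type [lipfree] itself. *)
Lemma lspan_delta_dense (m : lipfree o) (e : R) : 0 < e ->
  exists2 m', lspan deltas m' & `|m - m'| < e.
Proof.
suff /closure_normP : closure (lspan deltas) m by apply.
move: m; apply: lipfree_ind => [||a x y m /closure_normP Hm].
- exact: closed_closure.
- by apply: subset_closure; exact: lspan0.
- apply/closure_normP => d /Hm[m' sm' mm'].
  exists (a *: free_delta o x y + m').
    by apply: lspan_lin => //; apply: lspan_sub; exists (x, y).
  by rewrite opprD addrACA subrr add0r.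
Qed.

Lemma linearization_delta T x y :
  linearization T (free_delta o x y) = T x - T y.
Proof. by rewrite free_deltaB linearB/= !linearizationE. Qed.

Lemma bidual_eval_blin (v : E) :
  (fun phi : blin E R => phi v) \in @blin_pred R (blin E R) R.
Proof.
by apply/mem_set; split=> //; exists `|v| => phi; rewrite mulrC blin_normP.
Qed.

(** The canonical embedding of [E] into its bidual; composed with [T], it gives a point at which
    Lipschitz tensors can be evaluated. *)
Definition bidual_eval v : blin (blin E R) R := mkBlin (bidual_eval_blin v).

Lemma bidual_eval_lip0 T :
  (fun x => bidual_eval (T x)) \in @lip0_pred R X o (blin (blin E R) R).
Proof.
apply/mem_set; split.
  by apply/val_inj/funext => phi /=; rewrite lip0_base linear0.
exists `|T| => -[x y] /=; apply: (le_trans _ (lip0_normP T x y)).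
apply: blin_norm_le => // phi; rewrite mulrC.
rewrite -[X in `|X|]/(phi (T x) - phi (T y)) -linearB/=.
exact: blin_normP.
Qed.

Definition lip0_bidual T : Lip0 o (blin (blin E R) R) :=
  mkLip0 (bidual_eval_lip0 T).

Lemma lip_tens_bidual T x y (s : blin E R) :
  lip_tens x y s (lip0_bidual T) = s (T x - T y).
Proof. by rewrite linearB. Qed.

Lemma sum_lip_tens_eq T {l} {x y : 'I_l -> X} {s l'} {x' y' : 'I_l' -> X} {s'} :
  \sum_(k < l) lip_tens (E := E) (x k) (y k) (s k) =
    \sum_(k < l') lip_tens (o := o) (x' k) (y' k) (s' k) ->
  \sum_(k < l) s k (T (x k) - T (y k)) =
    \sum_(k < l') s' k (T (x' k) - T (y' k)).
Proof.
move=> /(congr1 (@^~ (lip0_bidual T))).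
rewrite !fct_sumE; under eq_bigr do rewrite lip_tens_bidual.
by under [in X in _ = X -> _]eq_bigr do rewrite lip_tens_bidual.
Qed.

(** Both sums are values of the same tensor at the bilinear form induced by [linearization T]. *)
Lemma sum_tens_eq T {n} {m : 'I_n -> lipfree o} {e l} {x y : 'I_l -> X}
    {s : 'I_l -> blin E R} :
  \sum_(i < n) tens (m i) (e i) =
    \sum_(k < l) tens (free_delta o (x k) (y k)) (s k) ->
  \sum_(i < n) e i (linearization T (m i)) =
    \sum_(k < l) s k (T (x k) - T (y k)).
Proof.
pose B : {bilinear lipfree o -> blin E R -> R | *%R & *%R} :=
  dual_pairing (linearization T).
move=> /(congr1 (@^~ B)); rewrite !fct_sumE /tens /= => ->.
by apply: eq_bigr => k _; rewrite /dual_pairing linearization_delta.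
Qed.

(** Expanding each [m i] gives a linear combination of elementary tensors, whose scalars are then
    absorbed into the functionals. *)
Lemma lspan_tens {n} (m : 'I_n -> lipfree o) (e : 'I_n -> blin E R) :
  (forall i, lspan deltas (m i)) ->
  exists l (x y : 'I_l -> X) (s : 'I_l -> blin E R),
    \sum_(i < n) tens (m i) (e i) =
      \sum_(k < l) tens (free_delta o (x k) (y k)) (s k).
Proof.
move=> sm; pose A := [set tens (free_delta o w.1.1 w.1.2) w.2 |
  w in [set: X * X * blin E R]].
have [l [a [w [Aw ->]]]] : lspan A (\sum_(i < n) tens (m i) (e i)).
  elim/big_ind : _ => [|u v Au Av|i _]; first exact: lspan0.
    by rewrite -[u]scale1r; exact: lspan_lin.
  move: (m i) (sm i); apply: lspan_ind => [|a _ v [[x y] _ <-] Av].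
    by rewrite tens0l; exact: lspan0.
  rewrite tensDl tensZ tensZr; apply: lspan_lin => //.
  by apply: lspan_sub; exists (x, y, e i).
have {Aw}/choice[f fE] : forall k, exists xys : X * X * blin E R,
    tens (free_delta o xys.1.1 xys.1.2) xys.2 = w k.
  by move=> k; have [xys _ <-] := Aw k; exists xys.
exists l, (fun k => (f k).1.1), (fun k => (f k).1.2), (fun k => a k *: (f k).2).
by apply: eq_bigr => k _; rewrite tensZr fE.
Qed.

(** * Comparison of the strict Lipschitz bound with the Cohen bound *)

Lemma wSL_le p n (m : 'I_n -> lipfree o) e l (x y : 'I_l -> X)
    (s : 'I_l -> blin E R) :
  \sum_(i < n) tens (m i) (e i) =
    \sum_(k < l) tens (free_delta o (x k) (y k)) (s k) ->
  wSL p (\sum_(k < l) lip_tens (o := o) (x k) (y k) (s k)) <=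
    weak_lp_norm p m * weak_lp_norm (hoelder_conjugate p) e.
Proof.
move=> me; apply: ge_inf; last by exists n, m, e, l, x, y, s.
exists 0 => _ [k [m' [e' [? [? [? [? [_ _ ->]]]]]]]].
by rewrite mulr_ge0// weak_lp_norm_ge0.
Qed.

Lemma nuclear_sl_nuclear_bound p T C : 0 < C ->
  nuclear_bound p (linearization T) C -> sl_nuclear_bound p T C.
Proof.
move=> C0 HC l x y s; rewrite mulrC -ler_pdivrMr//; apply: lb_le_inf.
  (* The tensor represents itself, so the infimum is over a nonempty set. *)
  exists (weak_lp_norm p (fun k => free_delta o (x k) (y k)) *
    weak_lp_norm (hoelder_conjugate p) s).
  by exists l, (fun k => free_delta o (x k) (y k)), s, l, x, y, s.
(* The [m i] and [e i] may represent another decomposition of the same functional, so the pairing is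
   first moved to that decomposition. *)
move=> _ [n [m [e [l' [x' [y' [s' [/(sum_lip_tens_eq T)-> me ->]]]]]]]].
rewrite ler_pdivrMr// mulrC -(sum_tens_eq T me) mulrA.
by apply: le_trans (HC n m e); exact: ler_norm_sum.
Qed.

(* The coefficients [e i] are multiplied by the signs of the pairings, which
   leaves their weak norm unchanged. *)
Lemma sl_nuclear_bound_lspan p T C n (m : 'I_n -> lipfree o)
    (e : 'I_n -> blin E R) : 0 <= C -> sl_nuclear_bound p T C ->
  (forall i, lspan deltas (m i)) ->
  \sum_(i < n) `|e i (linearization T (m i))| <=
    C * weak_lp_norm p m * weak_lp_norm (hoelder_conjugate p) e.
Proof.
move=> C0 HC sm.
pose e' i := (-1) ^+ (e i (linearization T (m i)) < 0)%R *: e i.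
have -> : weak_lp_norm (hoelder_conjugate p) e =
    weak_lp_norm (hoelder_conjugate p) e'.
  by apply: eq_weak_lp_norm => phi i; rewrite linearZ/= normrM normr_sign mul1r.
have -> : \sum_(i < n) `|e i (linearization T (m i))| =
    \sum_(i < n) e' i (linearization T (m i)).
  by apply: eq_bigr => i _; rewrite normrEsign.
have [l [x [y [s me]]]] := lspan_tens m e' sm.
rewrite (sum_tens_eq T me) -mulrA (le_trans (ler_norm _))//.
by apply: (le_trans (HC l x y s)); rewrite ler_wpM2l// wSL_le.
Qed.

Lemma sl_nuclear_nuclear_bound p T C : (1 <= p)%E -> 0 <= C ->
  sl_nuclear_bound p T C -> nuclear_bound p (linearization T) C.
Proof.
move=> p1 C0 HC n m e.
set w := weak_lp_norm (hoelder_conjugate p) e.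
have w0 : 0 <= w by exact: weak_lp_norm_ge0.
(* Replacing each [m i] by an element within [d] costs at most [d * (C * N * w)] through the weak
   norm and [d * K] through the pairings. *)
pose N := @lp_norm R n p (fun=> 1).
have N0 : 0 <= N by exact: lp_norm_ge0.
pose K := \sum_(i < n) `|e i| * `|linearization T|.
have K0 : 0 <= K by apply: sumr_ge0 => i _; rewrite mulr_ge0.
pose D := C * N * w + K.
have D0 : 0 <= D by rewrite addr_ge0// !mulr_ge0.
apply/ler_addgt0Pl => eps eps0.
(* The added 1 guards against [D = 0]. *)
pose d := eps / (D + 1).
have D1 : 0 < D + 1 by rewrite ltr_wpDl.
have d0 : 0 < d by exact: divr_gt0.
have d_ge0 := ltW d0.
have dD : d * D <= eps.
  by rewrite /d mulrAC ler_pdivrMr// ler_pM2l// lerDl.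
have /choice[m' m'P] : forall i, exists u, lspan deltas u /\ `|m i - u| < d.
  by move=> i; have [u su mu] := lspan_delta_dense (m i) d d0; exists u.
have sm' i : lspan deltas (m' i) by have [] := m'P i.
have mm' i : `|m i - m' i| <= d by apply: ltW; have [] := m'P i.
have := sl_nuclear_bound_lspan p T C n m' e C0 HC sm'.
have wm' : weak_lp_norm p m' <= weak_lp_norm p m + d * N.
  by apply: weak_lp_norm_perturb => // i; rewrite distrC.
rewrite -/w => H.
have {}H : \sum_(i < n) `|e i (linearization T (m' i))| <=
    C * (weak_lp_norm p m + d * N) * w.
  by apply: (le_trans H); rewrite ler_wpM2r// ler_wpM2l.
have H2 : \sum_(i < n) `|e i (linearization T (m i))| <=
    \sum_(i < n) `|e i (linearization T (m' i))| + d * K.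
  rewrite mulr_sumr -big_split/=; apply: ler_sum => i _.
  rewrite -lerBlDl (le_trans (lerB_dist _ _))// -!linearB/=.
  rewrite (le_trans (blin_normP _ _))// mulrCA ler_wpM2l//.
  by rewrite (le_trans (blin_normP _ _))// mulrC ler_wpM2r.
apply: (le_trans H2); apply: (@le_trans _ _ (d * D + C * weak_lp_norm p m * w)).
  apply: (le_trans (lerD H (lexx _))).
  by rewrite /D le_eqVlt; apply/predU1P; left; ring.
by rewrite lerD2r.
Qed.

Lemma sl_nuclear_boundP p T C : (1 <= p)%E -> 0 < C ->
  sl_nuclear_bound p T C <-> nuclear_bound p (linearization T) C.
Proof.
move=> p1 C0; split; last exact: nuclear_sl_nuclear_bound.
by apply: sl_nuclear_nuclear_bound => //; exact: ltW.
Qed.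

(** * Bijectivity and linearity of the linearization map *)

Lemma free_delta_norm x y : `|free_delta o x y| <= mdist x y.
Proof.
rewrite free_normE; apply: blin_norm_le => [|f /=]; first exact: mdist_ge0.
by rewrite mulrC; exact: lip0_normP.
Qed.

(** The map [x |-> free_delta o x o] does not increase distances, so [S] composed with it is
    Lipschitz; uniqueness identifies the linearization with [S]. *)
Lemma linearization_surj (S : blin (lipfree o) E) :
  exists T, linearization T = S.
Proof.
have ST : (fun x => S (free_delta o x o)) \in @lip0_pred R X o E.
  apply/mem_set; split; first by rewrite free_deltaB subrr linear0.
  exists `|S| => -[x y] /=; rewrite -linearB -free_deltaB/=.
  by rewrite (le_trans (blin_normP _ _))// ler_wpM2l// free_delta_norm.
by exists (mkLip0 ST); apply/esym/linearization_unique.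
Qed.

Lemma linearization_inj T1 T2 :
  linearization T1 = linearization T2 :> (lipfree o -> E) -> T1 = T2.
Proof.
move=> T12; apply/val_inj/funext => x /=.
by rewrite -!linearizationE T12.
Qed.

Lemma linearization_linear : linear (fun T => linearization T).
Proof.
move=> a T1 T2; apply/esym/linearization_unique => x.
by rewrite blinD blinZ !linearizationE.
Qed.

End LipschitzTensors.

Theorem theorem3p5 (R : realType) (p : \bar R) (hp : (1 <= p)%E)
    (X : metricType R) (o : X) (E : completeNormedModType R) :
  (forall T : Lip0 o E,
     sl_nuclear p T <-> nuclear p (linearization T : lipfree o -> E)) /\
  [/\ linear (fun T : Lip0 o E => linearization T),
      set_bij (@sl_nuclear R X o E p) (@nuclear R p (lipfree o) E)
        (fun T => linearization T : lipfree o -> E) &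
      forall T : Lip0 o E, sl_nuclear p T ->
        nuclear_norm p (linearization T : lipfree o -> E) =
        sl_nuclear_norm p T].
Proof.
have nuclearP (T : Lip0 o E) :
    sl_nuclear p T <-> nuclear p (linearization T : lipfree o -> E).
  split=> [[C [C0 HC]]|[_ [C [C0 HC]]]].
    split; first exact: blin_linear.
    by exists C; split=> //; apply/(sl_nuclear_boundP p T C hp C0).
  by exists C; split=> //; apply/(sl_nuclear_boundP p T C hp C0).
split=> //; split.
- exact: linearization_linear.
- split=> [T /nuclearP//|T1 T2 _ _|S nS]; first exact: linearization_inj.
  have [lS [C [C0 HC]]] := nS.
  (* A member of [nuclear] is a bare linear map; its Cohen bound makes it a [blin], to which
     surjectivity applies. *)
  have SC := nuclear_bound_norm p S C hp (ltW C0) HC.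
  have Sb : S \in @blin_pred R (lipfree o) E.
    by apply/mem_set; split=> //; exists C.
  have [T TS] := linearization_surj (mkBlin Sb).
  have {}TS : linearization T = S :> (lipfree o -> E) by rewrite TS.
  by exists T => //; apply/nuclearP; rewrite TS.
(* Both norms are infima of the same set of positive constants. *)
- move=> T _; rewrite /nuclear_norm /sl_nuclear_norm; congr (inf _).
  apply/seteqP; split=> C [C0 HC]; split=> //;
    exact/(sl_nuclear_boundP p T C hp C0).
Qed.
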